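(* Let $\mathsf V=(\mathsf V,\otimes,\mathsf k)$ be a completely distributive quantale. Then a $\mathsf V$-closure space $(X,c)$ is a $\mathsf V$-approach space if and only if its closure tower $(c^v)_{v\in\mathsf V}$ satisfies, for all coprime elements $p\in\mathsf V$ and all $A,B\subseteq X$: (C4') $c^p\emptyset=\emptyset$; (C5') $c^p(A\cup B)=c^pA\cup c^pB$.
   Context: A quantale $\mathsf V=(\mathsf V,\otimes,\mathsf k)$ is a complete lattice with a (not necessarily commutative) monoid structure whose operation $\otimes$ preserves arbitrary suprema in each variable; no relation between $\mathsf k$ and $\bot,\top$ is assumed. It is completely distributive if its underlying complete lattice is (in the ordinary sense; the Axiom of Choice is assumed). An element $p\in\mathsf V$ is coprime if $p>\bot$ and $p\le u\vee v$ always implies $p\le u$ or $p\le v$. A $\mathsf V$-closure space $(X,c)$ is a set $X$ with a map $c:\mathsf PX\to\mathsf V^X$ ($\mathsf PX$ the power set) such that (R') $\mathsf k\le c(\{x\})(x)$ for all $x\in X$; (T') $\big(\bigwedge_{y\in B}\bigvee_{A\in\mathcal A}(cA)(y)\big)\otimes (cB)(z)\le c(\bigcup\mathcal A)(z)$ for all $\mathcal A\subseteq\mathsf PX$, $B\subseteq X$, $z\in X$. It is a $\mathsf V$-approach space if in addition $(c\emptyset)(x)=\bot$ and $c(A\cup B)(x)=(cA)(x)\vee(cB)(x)$ for all $x\in X$, $A,B\subseteq X$. The closure tower of $(X,c)$ is the family of maps $c^v:\mathsf PX\to\mathsf PX$, $c^vA=\{x\in X\mid (cA)(x)\ge v\}$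 ($v\in\mathsf V$). *)

(* Defs.v *)
From HB Require Import structures.
From mathcomp Require Import all_boot all_order.
From mathcomp Require Import boolp classical_sets.

Set Implicit Arguments.
Unset Strict Implicit.
Unset Printing Implicit Defensive.

Import Order.TTheory.
Local Open Scope classical_set_scope.
Local Open Scope order_scope.

(* The finitary operations of the underlying bounded lattice are determined by
   its order, hence agree with the suprema and infima of finite sets. *)
HB.mixin Record isCompleteLattice d T of Order.TBLattice d T := {
  csup : set T -> T;
  csup_ubound : forall (S : set T) (x : T), S x -> x <= csup S;
  csup_least : forall (S : set T) (y : T),
    (forall x, S x -> x <= y) -> csup S <= y
}.

#[short(type="completeLatticeType")]
HB.structure Definition CompleteLattice d :=
  { T of isCompleteLattice d T & Order.TBLattice d T }.

Definition cinf d (T : completeLatticeType d) (S : set T) : T :=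
  csup [set y | forall x, S x -> y <= x].

HB.mixin Record isQuantale d V of CompleteLattice d V := {
  tensor : V -> V -> V;
  tunit : V;
  tensorA : associative tensor;
  tensor1v : left_id tunit tensor;
  tensorv1 : right_id tunit tensor;
  tensor_csupl : forall (S : set V) (v : V),
    tensor (csup S) v = csup [set tensor u v | u in S];
  tensor_csupr : forall (u : V) (S : set V),
    tensor u (csup S) = csup [set tensor u v | v in S]
}.

#[short(type="quantaleType")]
HB.structure Definition Quantale d :=
  { V of isQuantale d V & CompleteLattice d V }.

Definition completely_distributive d (L : completeLatticeType d) : Prop :=
  forall (I : Type) (J : I -> Type) (x : forall i, J i -> L),
    cinf [set csup [set x i j | j in [set: J i]] | i in [set: I]] =
    csup [set cinf [set x i (f i) | i in [set: I]] | f in [set: forall i, J i]].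

Definition coprime_element d (L : completeLatticeType d) (p : L) : Prop :=
  \bot < p /\ forall u v : L, p <= Order.join u v -> p <= u \/ p <= v.

Section ClosureSpaces.
Context {d : Order.disp_t} {V : quantaleType d} {X : Type}.
Implicit Type c : set X -> X -> V.

Definition V_closure_space c : Prop :=
  (forall x, tunit <= c [set x] x) /\
  (forall (AA : set (set X)) (B : set X) (z : X),
     tensor (cinf [set csup [set c A y | A in AA] | y in B]) (c B z)
     <= c (\bigcup_(A in AA) A) z).

Definition V_approach_space c : Prop :=
  [/\ V_closure_space c,
      forall x, c set0 x = \bot
    & forall (A B : set X) (x : X),
        c (A `|` B)%classic x = Order.join (c A x) (c B x)].

Definition closure_tower c (v : V) (A : set X) : set X :=
  [set x | v <= c A x].

End ClosureSpaces.

(* Main.v *)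
Require Import Defs.
From HB Require Import structures.
From mathcomp Require Import all_boot all_order.
From mathcomp Require Import boolp classical_sets.

(** Everything rests on the fact that in a completely distributive lattice
    coprime elements separate: if [a] is not below [b], some coprime [p <= a] is
    not below [b]. By complete distributivity, [a ≰ b] yields a pair [(x, y)]
    with [a ≰ x], [y ≰ b] such that every [z] satisfies [y <= z] or [z <= x].
    Iterating from [x 0 = b] gives sequences with [y (n+1) ≰ x n], the [x n]
    increasing and never above [a]; then [p = sup y n] works. *)

Import Order.LTheory.
Local Open Scope classical_set_scope.

Section CoprimeSeparation.
Context {d : Order.disp_t} {L : completeLatticeType d}.
Hypothesis hL : completely_distributive L.
Implicit Types a b p x y z : L.

Lemma cinf_lbound (S : set L) x : S x -> (cinf S <= x)%O.
Proof. by move=> Sx; apply: csup_least => y; apply. Qed.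

Lemma cinf_greatest (S : set L) y :
  (forall x, S x -> y <= x)%O -> (y <= cinf S)%O.
Proof. by move=> Sy; apply: csup_ubound. Qed.

(* The conclusion says that [y] is totally below [a]. *)
Lemma exists_totally_below a b : ~ (a <= b)%O ->
  exists y, ~ (y <= b)%O /\
    forall S : set L, (a <= csup S)%O -> exists2 s, S s & (y <= s)%O.
Proof.
move=> nab.
(* Distributivity is applied to the family of all [S] with [a <= csup S], so that each [f] picks an
   element from every such [S]. *)
pose I := {S : set L | (a <= csup S)%O}.
pose x (i : I) (j : {s | sval i s}) : L := sval j.
have a_le : (a <= csup [set cinf [set x i (f i) | i in [set: I]]
                       | f in [set: forall i : I, {s | sval i s}]])%O.
  rewrite -(hL I _ x); apply: cinf_greatest => _ [[S aS] _ <-].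
  apply: (le_trans aS); apply: csup_least => s Ss.
  by apply: csup_ubound; exists (exist _ s Ss).
(* The infimum along any [f] is totally below [a]; were all of these below [b], so would be their
   supremum, and hence [a]. *)
apply: contrapT => noy; apply/nab/(le_trans a_le)/csup_least => _ [f _ <-].
apply: contrapT => nfb; apply: noy.
exists (cinf [set x i (f i) | i in [set: I]]); split => // S aS.
exists (x (exist _ S aS) (f (exist _ S aS))); first exact: (proj2_sig (f (exist _ S aS))).
by apply: cinf_lbound; exists (exist _ S aS).
Qed.

(** Take [y] totally below [a] and [x] the supremum of all [z] not above [y]: if [a <= x], one of
    these [z] would be above [y]. *)
Lemma exists_splitting a b : ~ (a <= b)%O ->
  exists xy : L * L, [/\ ~ (a <= xy.1)%O, ~ (xy.2 <= b)%O
    & forall z, (xy.2 <= z)%O \/ (z <= xy.1)%O].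
Proof.
move=> /exists_totally_below[y [nyb ytb]].
exists (csup [set z | ~ (y <= z)%O], y); split=> //=.
  by move=> /ytb[s].
by move=> z; have [|nyz] := pselect (y <= z)%O; [left|right; exact: csup_ubound].
Qed.

Lemma exists_coprime_separating a b : ~ (a <= b)%O ->
  exists p, [/\ coprime_element p, (p <= a)%O & ~ (p <= b)%O].
Proof.
move=> nab.
have step x : exists xy : L * L, ~ (a <= x)%O -> [/\ ~ (a <= xy.1)%O,
    ~ (xy.2 <= x)%O & forall z, (xy.2 <= z)%O \/ (z <= xy.1)%O].
  have [ax|/exists_splitting[xy xyP]] := pselect (a <= x)%O; last by exists xy.
  (* A dummy pair where [a <= x], so that choice yields a total [g]; the sequence never reaches this
     case. *)
  by exists (x, x).
have [g gP] := choice step.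
pose x n := iter n (fun z => (g z).1) b.
pose y n := (g (x n)).2.
have nax n : ~ (a <= x n)%O by elim: n => //= n /gP[].
have nyx n : ~ (y n <= x n)%O by have [] := gP _ (nax n).
have yx n z : (y n <= z)%O \/ (z <= x n.+1)%O by have [_ _] := gP _ (nax n); apply.
have x_mono : {homo x : m n / m <= n >-> (m <= n)%O}.
  apply: homo_leq => [z|z u v|n]; [exact: lexx|exact: le_trans|].
  by case: (yx n (x n)) => // /nyx.
have yp n : (y n <= csup (range y))%O by apply: csup_ubound; exists n.
have npb : ~ (csup (range y) <= b)%O by move=> /(le_trans (yp 0)) /nyx.
(* Whatever is not above the supremum misses some [y n], hence falls under [x n.+1]. *)
have below_x z : ~ (csup (range y) <= z)%O -> exists n, (z <= x n)%O.
  move=> npz; apply: contrapT => nzx; apply/npz/csup_least => _ [n _ <-].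
  by case: (yx n z) => // zx; case: nzx; exists n.+1.
exists (csup (range y)); split=> //; last first.
  by apply: csup_least => _ [n _ <-]; case: (yx n a) => // /nax.
split.
  by rewrite lt0x; apply/eqP => p0; apply: npb; rewrite p0 le0x.
move=> u v puv; apply: contrapT => /not_orP[/below_x[m um] /below_x[n vn]].
(* At the larger index [N], both [u] and [v] lie under [x N], which would force [y N <= x N]. *)
apply: (nyx (maxn m n)); apply: (le_trans (yp _)); apply: (le_trans puv).
rewrite leUx (le_trans um) ?(le_trans vn) //; apply: x_mono.
  exact: leq_maxr.
exact: leq_maxl.
Qed.

(** Reduces inequalities in [L] to coprime levels, the only ones where the tower conditions give
    information. *)
Lemma le_coprime a b :
  (forall p, coprime_element p -> p <= a -> p <= b)%O -> (a <= b)%O.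
Proof.
move=> pab; apply: contrapT => /exists_coprime_separating[p [cp pa npb]].
exact/npb/pab.
Qed.

End CoprimeSeparation.

Theorem theorem2p11 (d : Order.disp_t) (V : quantaleType d)
    (hV : completely_distributive V) (X : Type) (c : set X -> X -> V)
    (hc : V_closure_space c) :
  V_approach_space c <->
  (forall p : V, coprime_element p -> forall A B : set X,
     closure_tower c p set0 = set0 /\
     closure_tower c p (A `|` B) = closure_tower c p A `|` closure_tower c p B).
Proof.
split=> [[_ c0 cU] p [p_gt0 p_prime] A B|tower].
  split; apply/seteqP; split=> x //; rewrite /closure_tower /=.
  - by rewrite c0 lt_geF.
  - by rewrite cU => /p_prime.
  - by rewrite cU => -[pA|pB]; rewrite ?(lexUl _ pA) ?(lexUr _ pB).
have towerU p A B x : coprime_element p ->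
    (p <= c (A `|` B) x)%O <-> (p <= c A x)%O \/ (p <= c B x)%O.
  move=> /tower /(_ A B)[_ /seteqP[UAB ABU]].
  by split=> [/UAB|/ABU].
split=> // [x|A B x]; apply/eqP.
  (* No coprime lies below [c set0 x], so the test against [\bot] is vacuous. *)
  rewrite -lex0; apply: (le_coprime hV) => p /tower /(_ set0 set0)[p0 _] pc.
  by have : closure_tower c p set0 x by []; rewrite p0.
rewrite eq_le; apply/andP; split; apply: (le_coprime hV) => p cp.
  by move=> /(towerU _ _ _ _ cp)[pA|pB]; rewrite ?(lexUl _ pA) ?(lexUr _ pB).
by move=> pAB; apply/(towerU _ _ _ _ cp); exact: (cp.2).
Qed.
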